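(* Let $A,B\in\mathbb{R}^{n\times n}$ and assume that the linear delay-differential equation $\dot x(t)=Ax(t)+Bx(t-\tau)$ is of universality class II, with corresponding frequencies $\omega_{H_1}>\omega_{H_2}>0$ and branch index $j$. Then the system possesses delay-induced transverse crossings of the characteristic roots at $\lambda_c=\pm i\omega_{H_m}$ for the following values of the time delay: $$\tau_k^{(m)}=\frac{1}{\omega_{H_m}}(\phi_{H_m}+2\pi k),\quad k=0,1,2,\dots,$$ where $m=1,2$ and $\phi_{H_m}=-\arg[Y_j(\omega_{H_m})]$. Moreover, there are no other delay-induced transverse crossings in the system. The crossings for $m=1$ are destabilizing and for $m=2$ stabilizing, i.e. $$\left.\frac{d}{d\tau}\operatorname{Re}[\lambda(\tau)]\right|_{\lambda=\pm i\omega_{H_1},\,\tau=\tau_k^{(1)}}>0,\qquad \left.\frac{d}{d\tau}\operatorname{Re}[\lambda(\tau)]\right|_{\lambda=\pm i\omega_{H_2},\,\tau=\tau_k^{(2)}}<0.$$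
   Context: The DDE is $\dot x(t)=Ax(t)+Bx(t-\tau)$ with real $n\times n$ matrices $A,B$ and time delay $\tau>0$ regarded as a parameter. Its characteristic equation is $\det[\lambda I-A-Be^{-\lambda\tau}]=0$; solutions $\lambda$ are called characteristic roots. Delay-induced transverse crossing at $\tau=\tau_H$: there is a family of roots $\lambda(\tau)=\alpha(\tau)\pm i\mu(\tau)$ of the characteristic equation with $\alpha(\tau_H)=0$ and $\frac{d\alpha}{d\tau}(\tau_H)\neq0$. It is called stabilizing if $\frac{d\alpha}{d\tau}(\tau_H)<0$ and destabilizing if $\frac{d\alpha}{d\tau}(\tau_H)>0$. Generating polynomial: $p_\omega(Y)=\det[i\omega I-A-BY]$. Asymptotic continuous spectrum (ACS): the collection of curves $\left\{\frac1\tau\gamma_j(\omega)+i\omega\right\}$, $\omega\in\mathbb{R}$, $j=1,\dots,m$, where $\gamma_j(\omega)=-\ln|Y_j(\omega)|$ and $Y_j(\omega)$ are the roots of the generating polynomial, $p_\omega(Y_j(\omega))=0$. Points $\omega$ for which the polynomial is degenerate, i.e. $p_\omega(Y)\equiv\det[i\omega I-A]$ for all $Y$, are excluded. A branch of the ACS is one of the functions $\gamma_j$. Universality class II: the ACS (and the DDE) is of universality class II if there exist real numbers $\omega_{H_1}>\omega_{H_2}>0$ such that for some $j,h\in\mathbb{N}$ (possibly equal): (i) $\gamma_j(\omega_{H_m})=0$ $(m=1,2)$ and $\gamma_j(\omega)>0$ for all $\omega\in(\omega_{H_2},\omega_{H_1})$; (ii) $\gamma_h(-\omega_{H_m})=0$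 $(m=1,2)$ and $\gamma_h(\omega)>0$ for all $\omega\in(-\omega_{H_1},-\omega_{H_2})$; (iii) $\omega_{H_m}$ and $-\omega_{H_m}$ are regular points of $\gamma_j$ and $\gamma_h$ respectively, i.e. $\frac{d}{d\omega}\gamma_h(-\omega_{H_m})$ and $\frac{d}{d\omega}\gamma_j(\omega_{H_m})$ exist and are nonzero; (iv) for all remaining values of $\omega$ and branches of the ACS not mentioned in (i)-(iii), the ACS is negative. $\arg$ denotes the principal argument in $(-\pi,\pi]$.
   Formalization: ''No other delay-induced transverse crossings'' is claimed only at ±iω where the generating polynomial p_ω is not degenerate; if p_ω vanishes identically, iω is a root for every delay, the ACS excludes ω, and further crossings there can occur. *)

(* Defs.v *)
From HB Require Import structures.
From mathcomp Require Import all_boot all_order all_algebra.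
From mathcomp Require Import all_classical all_reals all_analysis.
From mathcomp Require Import complex.
Set Implicit Arguments.
Unset Strict Implicit.
Unset Printing Implicit Defensive.
Import Order.TTheory GRing.Theory Num.Theory.
Import numFieldNormedType.Exports.
Local Open Scope ring_scope.
Local Open Scope complex_scope.

Section ComplexFunctions.
Variable R : realType.

Definition cexp (z : R[i]) : R[i] :=
  (expR (complex.Re z))%:C * (cos (complex.Im z) +i* sin (complex.Im z)).

Definition cabs (z : R[i]) : R :=
  Num.sqrt (complex.Re z ^+ 2 + complex.Im z ^+ 2).

(* Principal argument: since [acos] takes its values in [0, pi], for z != 0
   this is the argument in ]-pi, pi]. *)
Definition carg (z : R[i]) : R :=
  if 0 <= complex.Im z then acos (complex.Re z / cabs z)
  else - acos (complex.Re z / cabs z).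

End ComplexFunctions.

Section DelayEquation.
Variables (R : realType) (n : nat).
Implicit Types (A B : 'M[R]_n) (tau w : R).

Definition cmx A : 'M[R[i]]_n := map_mx (real_complex R) A.

Definition char_root A B tau (lambda : R[i]) : Prop :=
  \det (lambda%:M - cmx A - cexp (- (lambda * tau%:C)) *: cmx B) = 0.

(* p_w(Y) = det (i w I - A - B Y), as a polynomial in Y. *)
Definition gen_poly A B w : {poly R[i]} :=
  \det ((0 +i* w)%:P%:M - map_mx polyC (cmx A) - 'X *: map_mx polyC (cmx B)).

(* p_w is the constant polynomial det (i w I - A), which may be zero. *)
Definition degenerate A B w : Prop :=
  gen_poly A B w = (\det ((0 +i* w)%:M - cmx A))%:P.

(* The degree of p_w in Y may drop at some w, i.e. some of the m roots may
   escape to infinity; [Y j w = None] stands for Y_j(w) = oo. *)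
Definition gen_roots A B m (Y : 'I_m -> R -> option R[i]) : Prop :=
  forall w, ~ degenerate A B w ->
    gen_poly A B w = lead_coef (gen_poly A B w) *:
      \prod_(j < m) (if Y j w is Some y then 'X - y%:P else 1).

(* gamma = - ln |Y|, which is +oo at a root Y = 0 and -oo at Y = oo. *)
Definition acs_gamma (y : option R[i]) : \bar R :=
  (- lne (if y is Some z then (cabs z)%:E else +oo))%E.

Definition acs_branch m (Y : 'I_m -> R -> option R[i]) (j : 'I_m) : R -> \bar R :=
  fun w => acs_gamma (Y j w).

Definition regular_point (g : R -> \bar R) w : Prop :=
  derivable (fine \o g) w 1 /\ derive1 (fine \o g) w != 0.

(* Degenerate frequencies are excluded throughout. *)
Record universality_class_II A B m (Y : 'I_m -> R -> option R[i])
    (j h : 'I_m) (w1 w2 : R) : Prop := UniversalityClassII {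
  classII_freq : 0 < w2 < w1;
  classII_zero_pos : forall w, w \in [:: w1; w2] ->
    ~ degenerate A B w /\ acs_branch Y j w = 0%E;
  classII_gt0_pos : forall w, w2 < w < w1 -> ~ degenerate A B w ->
    (0 < acs_branch Y j w)%E;
  classII_zero_neg : forall w, w \in [:: w1; w2] ->
    ~ degenerate A B (- w) /\ acs_branch Y h (- w) = 0%E;
  classII_gt0_neg : forall w, - w1 < w < - w2 -> ~ degenerate A B w ->
    (0 < acs_branch Y h w)%E;
  classII_regular : forall w, w \in [:: w1; w2] ->
    regular_point (acs_branch Y j) w /\ regular_point (acs_branch Y h) (- w);
  classII_remaining : forall (l : 'I_m) w, ~ degenerate A B w ->
    ~~ ((l == j) && (w2 <= w <= w1)) ->
    ~~ ((l == h) && (- w1 <= w <= - w2)) ->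
    (acs_branch Y l w < 0)%E }.

(* A continuous family lambda(tau) = alpha(tau) +/- i mu(tau) of characteristic
   roots, defined for tau near tauH. *)
Definition root_family A B (tauH : R) (alpha mu : R -> R) : Prop :=
  \forall tau \near tauH,
    [/\ char_root A B tau (alpha tau +i* mu tau),
        char_root A B tau (alpha tau -i* mu tau),
        {for tau, continuous alpha} & {for tau, continuous mu}].

(* The family crosses the imaginary axis at +/- i w when tau = tauH. *)
Definition transverse_crossing A B (tauH w : R) (alpha mu : R -> R) : Prop :=
  [/\ root_family A B tauH alpha mu,
      alpha tauH = 0, mu tauH = w,
      derivable alpha tauH 1 & derive1 alpha tauH != 0].

Definition stabilizing (tauH : R) (alpha : R -> R) : Prop :=
  derive1 alpha tauH < 0.

Definition destabilizing (tauH : R) (alpha : R -> R) : Prop :=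
  0 < derive1 alpha tauH.

(* Y_j is finite at the frequencies where this is used, so the default value
   0 of [odflt] is irrelevant. *)
Definition crossing_phase m (Y : 'I_m -> R -> option R[i]) (j : 'I_m) w : R :=
  - carg (odflt 0 (Y j w)).

Definition crossing_delay m (Y : 'I_m -> R -> option R[i]) (j : 'I_m) w
    (k : nat) : R :=
  w^-1 * (crossing_phase Y j w + 2 * pi * k%:R).

End DelayEquation.

(* Main.v *)
Require Import Defs.
From mathcomp Require Import all_boot all_order all_algebra.
From mathcomp Require Import all_classical all_reals all_analysis.
From mathcomp Require Import complex ring lra.
Set Implicit Arguments.
Unset Strict Implicit.
Unset Printing Implicit Defensive.
Import Order.TTheory GRing.Theory Num.Theory.
Import numFieldNormedType.Exports.
Local Open Scope ring_scope.
Local Open Scope complex_scope.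

(* Write [P(x, y) = det (x - A - B y)], so that [i w] is a characteristic root
   for the delay [tau] iff [P(i w, exp(- i w tau)) = 0]. The modulus of
   [exp(- i w tau)] is 1, so imaginary roots occur only where the spectrum
   vanishes, i.e. at [w = +/- wH], and there [exp(- i wH tau) = Y_j(wH) =: z]
   because all other roots of the generating polynomial lie outside the unit
   disc. This determines the delays.
   The root [z] is simple, [P_y <> 0]. With [p = P_x / (z P_y)] implicit
   differentiation gives [gamma_j'(wH) = - Im p] along the spectrum and
   [lambda'(tau) = i wH / (p - tau)] along a family of characteristic roots,
   whence [Re lambda' = - wH gamma_j'(wH) / |p - tau|^2]: the denominator does
   not vanish since [Im p <> 0], and the sign is opposite to that of
   [gamma_j'(wH)]. The latter is negative at [w1] and positive at [w2], because
   [gamma_j > 0] between them. *)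

(** * The real-valued modulus of complex numbers *)

Section ComplexModulus.
Local Open Scope classical_set_scope.
Variable R : realType.
Implicit Types z u v : R[i].

Lemma normc_cabs z : `|z| = (cabs z)%:C.
Proof. by rewrite normc_def. Qed.

Lemma cabs_ge0 z : 0 <= cabs z.
Proof. exact: sqrtr_ge0. Qed.

Lemma cabs_eq0 z : (cabs z == 0) = (z == 0).
Proof. by rewrite -[RHS]normr_eq0 normc_cabs eq_complex /= eqxx andbT. Qed.

Lemma cabs_gt0 z : (0 < cabs z) = (z != 0).
Proof. by rewrite lt_neqAle cabs_ge0 andbT eq_sym cabs_eq0. Qed.

Lemma cabs0 : cabs (0 : R[i]) = 0.
Proof. by apply/eqP; rewrite cabs_eq0. Qed.

Lemma cabsM u v : cabs (u * v) = cabs u * cabs v.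
Proof. by apply: complexI; rewrite rmorphM /= -!normc_cabs normrM. Qed.

Lemma cabsD u v : cabs (u + v) <= cabs u + cabs v.
Proof. by rewrite -lecR rmorphD /= -!normc_cabs ler_normD. Qed.

Lemma cabsN u : cabs (- u) = cabs u.
Proof. by apply: complexI; rewrite -!normc_cabs normrN. Qed.

Lemma cabsC (x : R) : cabs x%:C = `|x|.
Proof. by rewrite /cabs /= expr0n addr0 sqrtr_sqr. Qed.

Lemma cabsB u v : cabs (u - v) = cabs (v - u).
Proof. by rewrite -cabsN opprB. Qed.

Lemma Re_le_cabs z : `|complex.Re z| <= cabs z.
Proof. by rewrite -lecR -normc_cabs normc_ge_Re. Qed.

Lemma Im_le_cabs z : `|complex.Im z| <= cabs z.
Proof. by rewrite -[X in X <= _]sqrtr_sqr ler_wsqrtr // lerDr sqr_ge0. Qed.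

Lemma cabs_le_ReIm z : cabs z <= `|complex.Re z| + `|complex.Im z|.
Proof.
rewrite -[leRHS]ger0_norm ?addr_ge0// -[leRHS]sqrtr_sqr ler_wsqrtr//.
by by rewrite sqrrD !real_normK ?num_real// addrAC lerDl mulrn_wge0 ?mulr_ge0.
Qed.

Lemma cabs_sqr z : cabs z ^+ 2 = complex.Re z ^+ 2 + complex.Im z ^+ 2.
Proof. by rewrite sqr_sqrtr// addr_ge0 ?sqr_ge0. Qed.

Lemma cabs_dist u v : `|cabs u - cabs v| <= cabs (u - v).
Proof.
have := cabsD (u - v) v; have := cabsD (v - u) u.
by rewrite !subrK cabsB ler_norml => ? ?; apply/andP; split; lra.
Qed.

Lemma ReD u v : complex.Re (u + v) = complex.Re u + complex.Re v.
Proof. by case: u v => ? ? []. Qed.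
Lemma ReZ (x : R) (u : R[i]) : complex.Re (x%:C * u) = x * complex.Re u.
Proof. by case: u => a b /=; rewrite mul0r subr0. Qed.
Lemma ReB u v : complex.Re (u - v) = complex.Re u - complex.Re v.
Proof. by case: u v => ? ? []. Qed.
Lemma ImB u v : complex.Im (u - v) = complex.Im u - complex.Im v.
Proof. by case: u v => ? ? []. Qed.

End ComplexModulus.

(** * Limits in the complex plane and compactness of discs *)

Section ComplexTopology.
Local Open Scope classical_set_scope.
Variable R : realType.
Local Notation K := (R[i])^o.

Lemma cvg_cabsP (T : Type) (F : set_system T) {FF : Filter F} (f : T -> K) (l : K) :
  f @ F --> l <->
  forall e : R, 0 < e -> \forall t \near F, cabs (f t - l) < e.
Proof.
split=> [/cvgrPdist_lt cf e e0|cf].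
  have := cf e%:C; rewrite ltcR => /(_ e0).
  by apply: filterS => t; rewrite normc_cabs ltcR cabsB.
(* A complex [e] with [0 < e] has zero imaginary part, so its real part serves as the radius. *)
apply/cvgrPdist_lt => e; rewrite ltcE => /andP[/eqP Ime Ree].
apply: filterS (cf _ Ree) => t; rewrite normc_cabs ltcE/= Ime eqxx/=.
by rewrite cabsB.
Qed.

Lemma cvg_complexP (T : Type) (F : set_system T) {FF : Filter F} (f : T -> K) (l : K) :
  f @ F --> l <->
  ((fun t => complex.Re (f t)) @ F --> (complex.Re l : R)) /\
  ((fun t => complex.Im (f t)) @ F --> (complex.Im l : R)).
Proof.
split=> [/cvg_cabsP cf|[cr ci]].
  split; apply/cvgrPdist_lt => e e0; apply: filterS (cf _ e0) => t;
    apply: le_lt_trans; rewrite distrC -?ReB -?ImB; [exact: Re_le_cabs|exact: Im_le_cabs].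
apply/cvg_cabsP => e e0.
have e20 : 0 < e / 2 by rewrite divr_gt0.
move/cvgrPdist_lt/(_ _ e20): cr => cr; move/cvgrPdist_lt/(_ _ e20): ci => ci.
apply: filterS2 cr ci => t cr ci.
apply: le_lt_trans (cabs_le_ReIm _) _.
by rewrite ReB ImB distrC (distrC _ (complex.Im l)) [ltRHS]splitr ltrD.
Qed.

Lemma cvg_cabs (T : Type) (F : set_system T) {FF : Filter F} (f : T -> K) (l : K) :
  f @ F --> l -> (fun t => cabs (f t)) @ F --> (cabs l : R).
Proof.
move=> /cvg_cabsP cf; apply/cvgrPdist_lt => e /cf; apply: filterS => t.
by apply: le_lt_trans; rewrite cabsB cabs_dist.
Qed.

Lemma cvg_real_complex (T : Type) (F : set_system T) {FF : Filter F}
    (f : T -> R) (l : R) :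
  f @ F --> l -> (fun t => (f t)%:C : K) @ F --> (l%:C : K).
Proof. by move=> cf; apply/cvg_complexP; split=> //=; exact: cvg_cst. Qed.

Lemma closed_disc (c : K) (r : R) : closed [set z : K | cabs (z - c) <= r].
Proof.
rewrite (_ : mkset _ = (fun z : K => cabs (z - c)) @^-1` [set x | x <= r])//.
apply: closed_comp; last exact: closed_le.
move=> z _; apply: (@cvg_cabs K (nbhs z) _ (fun z => z - c) (z - c)).
by apply: cvgB; [exact: cvg_id|exact: cvg_cst].
Qed.

(** The disc is a closed subset of the continuous image of a real square, which is compact. *)
Lemma compact_disc (c : K) (r : R) : compact [set z : K | cabs (z - c) <= r].
Proof.
pose f (p : R * R) : K := p.1 +i* p.2.
pose S := `[complex.Re c - r, complex.Re c + r]%classic `*`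
          `[complex.Im c - r, complex.Im c + r]%classic.
apply: (@subclosed_compact _ _ (f @` S)).
- exact: closed_disc.
- apply: continuous_compact; last by apply: compact_setX; exact: segment_compact.
  apply: continuous_subspaceT => p; apply/cvg_complexP; split => /=.
    exact: cvg_fst.
  exact: cvg_snd.
- move=> z /= zr; exists (complex.Re z, complex.Im z); last by case: (z).
  split => /=; rewrite in_itv/= -ler_distl.
    by rewrite -ReB; apply: le_trans zr; exact: Re_le_cabs.
  by rewrite -ImB; apply: le_trans zr; exact: Im_le_cabs.
Qed.

Lemma near0_shift (w : R) (P : R -> Prop) :
  (\forall v \near w, P v) -> \forall e \near (0 : R)^', P (e + w).
Proof.
move=> Pw; apply: nbhs_dnbhs.
have : (fun e : R => e + w) @ (0 : R) --> w.
  rewrite -[X in _ --> X]add0r; apply: cvgD; [exact: cvg_id|exact: cvg_cst].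
exact.
Qed.

End ComplexTopology.

(** * The complex exponential and the principal argument *)

Section ComplexExponential.
Local Open Scope classical_set_scope.
Variable R : realType.
Local Notation K := (R[i])^o.
Implicit Types (u v z : R[i]) (x : R).

Lemma cexp0 : cexp (0 : R[i]) = 1.
Proof. by rewrite /cexp /= expR0 cos0 sin0 mul1r. Qed.

Lemma cexpD u v : cexp (u + v) = cexp u * cexp v.
Proof.
case: u v => a b [c d]; rewrite /cexp /= expRD cosD sinD.
by apply/eqP; rewrite eq_complex /=; apply/andP; split; apply/eqP; ring.
Qed.

Lemma cexp_conjc z : cexp z^* = (cexp z)^*.
Proof.
case: z => a b; rewrite /cexp /= cosN sinN.
by apply/eqP; rewrite eq_complex /=; apply/andP; split; apply/eqP; ring.
Qed.

Lemma cexp_im x : cexp (0 +i* x) = cos x +i* sin x.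
Proof. by rewrite /cexp /= expR0 mul1r. Qed.

Lemma cabs_cexp_im x : cabs (cexp (0 +i* x)) = 1.
Proof. by rewrite cexp_im /cabs /= cos2Dsin2 sqrtr1. Qed.

(** The value [d] fills the gap at [0], so the quotient can be composed with functions that vanish
    at some points. *)
Definition slope0 (f : R -> R) (d x : R) : R :=
  if x == 0 then d else (f x - f 0) / x.

Lemma slope0E f d x : f x - f 0 = slope0 f d x * x.
Proof.
rewrite /slope0; have [->|x0] := eqVneq x 0; first by rewrite mulr0 subrr.
by rewrite mulfVK.
Qed.

Lemma cvg_slope0 f d : is_derive (0 : R) (1 : R) f d ->
  slope0 f d x @[x --> (0 : R)] --> d.
Proof.
move=> [df dfE]; apply/cvgrPdist_lt => e e0.
have : (fun h => h^-1 *: ((f \o shift 0) (h *: 1) - f 0)) @ 0^' --> d.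
  by rewrite -dfE; exact: df.
move=> /cvgrPdist_lt/(_ _ e0).
rewrite /dnbhs /= near_withinE; apply: filterS => x h; rewrite /slope0.
case: eqP => [_|/eqP x0]; first by rewrite subrr normr0.
by have := h x0; rewrite /= /GRing.scale/= addr0 mulr1 mulrC.
Qed.

Definition cexp_slope u := if u == 0 then 1 else (cexp u - 1) / u.

Lemma cexp_slopeE u : cexp u - 1 = cexp_slope u * u.
Proof.
rewrite /cexp_slope; have [->|u0] := eqVneq u 0.
  by rewrite mulr0 cexp0 subrr.
by rewrite mulfVK.
Qed.

(** For [u = a + i b], the real slopes of exp, cos and sin give [cexp u - 1 - u = a X + b Z] with
    [X] and [Z] tending to [0]. Since [a] and [b] are bounded by the modulus of [u], division by [u]
    leaves an error of at most [cabs X + cabs Z]. *)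
Lemma cvg_cexp_slope (T : Type) (F : set_system T) {FF : Filter F} (u : T -> K) :
  u @ F --> (0 : K) -> (fun t => cexp_slope (u t) : K) @ F --> (1 : K).
Proof.
move=> /cvg_complexP[/= ca cb].
pose E := slope0 expR 1; pose C := slope0 cos (0 : R); pose S := slope0 sin (1 : R).
have cE : (fun t => E (complex.Re (u t))) @ F --> (1 : R).
  apply: cvg_comp ca (cvg_slope0 _).
  by rewrite -[X in is_derive _ _ _ X]expR0; exact: is_derive_expR.
have cC : (fun t => C (complex.Im (u t))) @ F --> (0 : R).
  apply: cvg_comp cb (cvg_slope0 _).
  by rewrite -[X in is_derive _ _ _ X]oppr0 -[X in - X]sin0; exact: is_derive_cos.
have cS : (fun t => S (complex.Im (u t))) @ F --> (1 : R).
  apply: cvg_comp cb (cvg_slope0 _).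
  by rewrite -[X in is_derive _ _ _ X]cos0; exact: is_derive_sin.
pose X t : K := (E (complex.Re (u t)) * (1 + complex.Im (u t) * C (complex.Im (u t))) - 1)
  +i* (E (complex.Re (u t)) * (complex.Im (u t) * S (complex.Im (u t)))).
pose Z t : K := C (complex.Im (u t)) +i* (S (complex.Im (u t)) - 1).
have cX : X @ F --> (0 : K).
  apply/cvg_complexP; split=> /=.
    rewrite [X in _ --> X](_ : _ = 1 * (1 + 0 * 0) - 1 :> R); last by ring.
    apply: cvgB; last exact: cvg_cst.
    apply: cvgM => //; apply: cvgD; first exact: cvg_cst.
    exact: cvgM.
  rewrite [X in _ --> X](_ : _ = 1 * (0 * 1) :> R); last by ring.
  by apply: cvgM => //; apply: cvgM.
have cZ : Z @ F --> (0 : K).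
  apply/cvg_complexP; split=> //=.
  by rewrite -(subrr (1 : R)); apply: cvgB => //; exact: cvg_cst.
have cXZ : (fun t => cabs (X t) + cabs (Z t)) @ F --> (0 : R).
  rewrite -[X in _ --> X](addr0 0) -(cabs0 R); apply: cvgD; exact: cvg_cabs.
apply/cvg_cabsP => e e0.
have /cvgrPdist_lt/(_ _ e0) := cXZ.
apply: filterS => t; rewrite sub0r normrN ger0_norm ?addr_ge0 ?cabs_ge0//.
apply: le_lt_trans.
rewrite /cexp_slope; case: eqP => [_|/eqP u0].
  by rewrite subrr cabs0 addr_ge0 ?cabs_ge0.
have key : cexp (u t) - 1 - u t =
    (complex.Re (u t))%:C * X t + (complex.Im (u t))%:C * Z t.
  have hE := slope0E expR 1 (complex.Re (u t)).
  have hC := slope0E cos 0 (complex.Im (u t)).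
  have hS := slope0E sin 1 (complex.Im (u t)).
  rewrite expR0 in hE; rewrite cos0 in hC; rewrite sin0 subr0 in hS.
  rewrite /X /Z -/E -/C -/S in hE hC hS *.
  move: (E _) (C _) (S _) hE hC hS => e1 c1 s1.
  case: (u t) => a b /=; rewrite /cexp /=.
  move=> /(canRL (subrK _))-> /(canRL (subrK _))-> ->.
  by apply/eqP; rewrite eq_complex /=; apply/andP; split; apply/eqP; ring.
have ut0 : 0 < cabs (u t) by rewrite cabs_gt0.
rewrite -(ler_pM2r ut0) -cabsM mulrBl mulfVK// mul1r key.
apply: le_trans (cabsD _ _) _; rewrite !cabsM !cabsC mulrDl.
by apply: lerD; rewrite mulrC ler_wpM2l ?cabs_ge0 ?Re_le_cabs ?Im_le_cabs.
Qed.

Lemma cvg_cexp (T : Type) (F : set_system T) {FF : Filter F} (u : T -> K) (l : K) :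
  u @ F --> l -> (fun t => cexp (u t) : K) @ F --> (cexp l : K).
Proof.
move=> cu.
have cul : (fun t => u t - l) @ F --> (0 : K).
  by rewrite -(subrr l); apply: cvgB => //; exact: cvg_cst.
rewrite (_ : (fun t => _) =
   (fun t => cexp l * (cexp_slope (u t - l) * (u t - l) + 1))); last first.
  by apply/funext => t; rewrite -cexp_slopeE subrK -cexpD addrC subrK.
rewrite [X in _ --> X](_ : _ = cexp l * (1 * 0 + 1) :> K); last first.
  by rewrite mulr0 add0r mulr1.
apply: cvgM; first exact: cvg_cst.
apply: cvgD; last exact: cvg_cst.
by apply: cvgM; [exact: cvg_cexp_slope|exact: cul].
Qed.

Lemma cexp_2pi_int (k : int) : cexp (0 +i* (2 * pi * k%:~R)) = 1 :> R[i].
Proof.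
have nat_case (m : nat) : cexp (0 +i* (2 * pi * m%:R)) = 1 :> R[i].
  rewrite cexp_im -[_ * _%:R]add0r mulr_natr mulr_natl.
  by rewrite (periodicn (@cosD2pi R)) (periodicn (@sinD2pi R)) cos0 sin0.
case: k => m; first exact: nat_case.
have := nat_case m.+1; rewrite !cexp_im => -[c s].
by rewrite NegzE mulrNz mulrN cosN sinN c s oppr0.
Qed.

(** Reduce [x] modulo [2 * pi] to [r]. Then [cos r = 1 - 2 sin(r / 2)^2] forces [sin (r / 2) = 0],
    whereas the sine is positive on the open interval from [0] to [pi]; so [r = 0]. *)
Lemma cos_eq1 x : cos x = 1 -> exists k : int, x = 2 * pi * k%:~R.
Proof.
move=> cx; have p0 := @pi_gt0 R; have pp0 : 0 < 2 * pi :> R by rewrite mulr_gt0.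
exists (Num.floor (x / (2 * pi))); set k := Num.floor _.
pose r := x - 2 * pi * k%:~R.
have r0 : 0 <= r by rewrite subr_ge0 mulrC -ler_pdivlMr// floor_le_tmp.
have r1 : r < 2 * pi.
  rewrite ltrBlDr -[X in X + _]mulr1 -mulrDr mulrC -ltr_pdivrMr// addrC.
  by have := floorD1_gt (x / (2 * pi)); rewrite intrD.
have cr : cos r = 1.
  have := cexp_2pi_int k; rewrite cexp_im => -[ck sk].
  by rewrite /r cosB ck sk cx mulr1 mulr0 addr0.
have : sin (r / 2) ^+ 2 = 0.
  have r2 : r / 2 *+ 2 = r by rewrite -mulr_natr divfK ?pnatr_eq0.
  by have := cos_mulr2n (r / 2); rewrite r2 cr sin2cos2 => h; lra.
move=> /eqP; rewrite sqrf_eq0 => /eqP s0.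
move: r0; rewrite le_eqVlt => /predU1P[/esym/eqP|r0].
  by rewrite subr_eq0 => /eqP.
have := @sin_gt0_pi R (r / 2); rewrite s0 ltxx => /(_ _).
by rewrite divr_gt0// ltr_pdivrMr// mulrC r1 => /(_ isT).
Qed.

Lemma cexp_im_inj s t : cexp (0 +i* s) = cexp (0 +i* t) :> R[i] ->
  exists k : int, s = t + 2 * pi * k%:~R.
Proof.
rewrite !cexp_im => -[cE sE].
have : cos (s - t) = 1 by rewrite cosB cE sE -!expr2 cos2Dsin2.
by move=> /cos_eq1[k kE]; exists k; rewrite -kE addrC subrK.
Qed.

Lemma cabs1_Re z : cabs z = 1 -> -1 <= complex.Re z <= 1.
Proof. by move=> z1; rewrite -ler_norml -z1 Re_le_cabs. Qed.

Lemma cexp_carg z : cabs z = 1 -> cexp (0 +i* carg z) = z.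
Proof.
move=> z1; have rez := cabs1_Re z1.
have ez : Num.sqrt (1 - complex.Re z ^+ 2) = `|complex.Im z|.
  by rewrite -sqrtr_sqr -[X in X - _](expr1n _ 2) -z1 cabs_sqr addrC addKr.
rewrite cexp_im /carg z1 divr1; case: ifPn => im0.
  by rewrite acosK ?in_itv// sin_acos// ez ger0_norm//; case: (z).
rewrite cosN sinN acosK ?in_itv// sin_acos// ez ltr0_norm ?ltNge// opprK.
by case: (z).
Qed.

Lemma carg_bounds z : cabs z = 1 -> - pi < carg z <= pi.
Proof.
move=> z1; have rez := cabs1_Re z1; have p0 := @pi_gt0 R.
rewrite /carg z1 divr1; case: ifPn => im0.
  rewrite acos_lepi// andbT (lt_le_trans _ (acos_ge0 rez))//.
  by rewrite oppr_lt0.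
have /andP[h1 h2] := rez.
(* Below the real axis [acos] stays under [pi]: real part [-1] and modulus [1] would force a zero
   imaginary part. This makes the lower bound strict. *)
rewrite ltrN2 acos_ltpi ?h2 ?andbT/=; last first.
  rewrite lt_neqAle h1 andbT; apply: contraNneq im0 => e.
  have := cabs_sqr z; rewrite z1 -e sqrrN expr1n => /eqP.
  by rewrite addrC -subr_eq subrr eq_sym sqrf_eq0 => /eqP->.
by rewrite (le_trans _ (ltW p0))// oppr_le0 acos_ge0.
Qed.

End ComplexExponential.

(** * Strict differentiability of functions of two variables *)

Section StrictDerivative.
Local Open Scope classical_set_scope.
Variable K : numFieldType.
Implicit Types (f g : K -> K -> K) (x y a b c : K).

(* Strict derivative at [(x0, y0)] with partial derivatives [a] and [b], in
   Caratheodory's form: the difference quotients are functions with a limit. *)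
Definition sderiv f x0 y0 a b : Prop :=
  forall (T : Type) (F : set_system T) (FF : Filter F) (x x' y y' : T -> K),
    x @ F --> x0 -> x' @ F --> x0 -> y @ F --> y0 -> y' @ F --> y0 ->
  exists D1 D2 : T -> K,
    [/\ D1 @ F --> a, D2 @ F --> b &
      forall t, f (x t) (y t) - f (x' t) (y' t) =
                D1 t * (x t - x' t) + D2 t * (y t - y' t)].

Definition sderivable f x0 y0 := exists a b, sderiv f x0 y0 a b.

Lemma sderivable_ext f g x0 y0 : (forall x y, f x y = g x y) ->
  sderivable f x0 y0 -> sderivable g x0 y0.
Proof.
move=> fg [a [b fab]]; exists a, b => T F FF x x' y y' cx cx' cy cy'.
have [D1 [D2 [c1 c2 E]]] := fab _ _ _ _ _ _ _ cx cx' cy cy'.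
by exists D1, D2; split=> // t; rewrite -!fg.
Qed.

Lemma sderiv_cvg f x0 y0 a b (T : Type) (F : set_system T) {FF : Filter F}
    (x y : T -> K) : sderiv f x0 y0 a b -> x @ F --> x0 -> y @ F --> y0 ->
  (fun t => f (x t) (y t)) @ F --> f x0 y0.
Proof.
move=> fab cx cy.
have [D1 [D2 [c1 c2 E]]] :=
  fab _ _ _ _ _ _ _ cx (@cvg_cst _ _ _ _ _) cy (@cvg_cst _ _ _ _ _).
rewrite (_ : (fun t => _) =
  (fun t => (D1 t * (x t - x0) + D2 t * (y t - y0)) + f x0 y0)); last first.
  by apply/funext => t; rewrite -E subrK.
rewrite -[X in _ --> X]add0r -[X in _ --> X + _](addr0 0).
rewrite -[X in _ --> X + _ + _](mulr0 a) -[X in _ --> _ + X + _](mulr0 b).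
apply: cvgD; last exact: cvg_cst.
apply: cvgD; apply: cvgM => //.
  by rewrite -(subrr x0); apply: cvgB => //; exact: cvg_cst.
by rewrite -(subrr y0); apply: cvgB => //; exact: cvg_cst.
Qed.

Lemma sderivable_cst c x0 y0 : sderivable (fun _ _ => c) x0 y0.
Proof.
exists 0, 0 => T F FF x x' y y' *; exists (cst 0), (cst 0).
by split; [exact: cvg_cst|exact: cvg_cst|move=> t; rewrite !mul0r subrr addr0].
Qed.

Lemma sderivable_fst x0 y0 : sderivable (fun x _ => x) x0 y0.
Proof.
exists 1, 0 => T F FF x x' y y' *; exists (cst 1), (cst 0).
by split; [exact: cvg_cst|exact: cvg_cst|move=> t; rewrite !mul0r mul1r addr0].
Qed.

Lemma sderivable_snd x0 y0 : sderivable (fun _ y => y) x0 y0.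
Proof.
exists 0, 1 => T F FF x x' y y' *; exists (cst 0), (cst 1).
by split; [exact: cvg_cst|exact: cvg_cst|move=> t; rewrite !mul0r mul1r add0r].
Qed.

Lemma sderivableD f g x0 y0 : sderivable f x0 y0 -> sderivable g x0 y0 ->
  sderivable (fun x y => f x y + g x y) x0 y0.
Proof.
move=> [a [b fab]] [a' [b' gab]]; exists (a + a'), (b + b').
move=> T F FF x x' y y' cx cx' cy cy'.
have [D1 [D2 [c1 c2 E]]] := fab _ _ _ _ _ _ _ cx cx' cy cy'.
have [G1 [G2 [d1 d2 G]]] := gab _ _ _ _ _ _ _ cx cx' cy cy'.
exists (fun t => D1 t + G1 t), (fun t => D2 t + G2 t); split.
- exact: cvgD.
- exact: cvgD.
- by move=> t; rewrite opprD addrACA E G !mulrDl addrACA.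
Qed.

Lemma sderivableM f g x0 y0 : sderivable f x0 y0 -> sderivable g x0 y0 ->
  sderivable (fun x y => f x y * g x y) x0 y0.
Proof.
move=> [a [b fab]] [a' [b' gab]].
exists (a * g x0 y0 + f x0 y0 * a'), (b * g x0 y0 + f x0 y0 * b').
move=> T F FF x x' y y' cx cx' cy cy'.
have [D1 [D2 [c1 c2 E]]] := fab _ _ _ _ _ _ _ cx cx' cy cy'.
have [G1 [G2 [d1 d2 G]]] := gab _ _ _ _ _ _ _ cx cx' cy cy'.
have cg := sderiv_cvg (FF := FF) gab cx cy.
have cf := sderiv_cvg (FF := FF) fab cx' cy'.
exists (fun t => D1 t * g (x t) (y t) + f (x' t) (y' t) * G1 t),
  (fun t => D2 t * g (x t) (y t) + f (x' t) (y' t) * G2 t); split.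
- by apply: cvgD; apply: cvgM.
- by apply: cvgD; apply: cvgM.
- move=> t; transitivity ((f (x t) (y t) - f (x' t) (y' t)) * g (x t) (y t) +
    f (x' t) (y' t) * (g (x t) (y t) - g (x' t) (y' t))); first by ring.
  by rewrite E G; ring.
Qed.

(** The Leibniz formula is a finite sum of finite products of entries: one induction runs over the
    permutations, an inner one over the rows. *)
Lemma sderivable_det n (M : K -> K -> 'M[K]_n) x0 y0 :
  (forall i j, sderivable (fun x y => M x y i j) x0 y0) ->
  sderivable (fun x y => \det (M x y)) x0 y0.
Proof.
move=> dM; rewrite /determinant.
elim: (index_enum _) => [|s r IH].
  apply: sderivable_ext (sderivable_cst 0 x0 y0) => x y.
  by rewrite big_nil.
apply: sderivable_ext (fun x y => esym (big_cons _ _ _ _ _ _)) _.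
apply: sderivableD IH; apply: sderivableM; first exact: sderivable_cst.
elim: (index_enum _) => [|i l IH].
  by apply: sderivable_ext (sderivable_cst 1 x0 y0) => x y; rewrite big_nil.
apply: sderivable_ext (fun x y => esym (big_cons _ _ _ _ _ _)) _.
exact: sderivableM.
Qed.

(** Implicit differentiation solves for the second variable; the flip lets it solve for the root as
    a function of the delay. *)
Lemma sderiv_flip f x0 y0 a b :
  sderiv f x0 y0 a b -> sderiv (fun y x => f x y) y0 x0 b a.
Proof.
move=> fab T F FF x x' y y' cx cx' cy cy'.
have [D1 [D2 [c1 c2 E]]] := fab _ _ _ _ _ _ _ cy cy' cx cx'.
by exists D2, D1; split=> // t; rewrite E addrC.
Qed.

(* [h] is the increment of the parameter on which [x] and [y] depend. *)
Lemma sderiv_implicit f x0 y0 a b s (T : Type) (F : set_system T) {FF : Filter F}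
    (x y h : T -> K) :
  sderiv f x0 y0 a b -> b != 0 -> f x0 y0 = 0 ->
  x @ F --> x0 -> y @ F --> y0 ->
  (\forall t \near F, f (x t) (y t) = 0) ->
  (fun t => (h t)^-1 * (x t - x0)) @ F --> s ->
  (fun t => (h t)^-1 * (y t - y0)) @ F --> - (a * s) / b.
Proof.
move=> fab b0 f0 cx cy fxy cs.
have [D1 [D2 [c1 c2 E]]] :=
  fab _ _ _ _ _ _ _ cx (@cvg_cst _ _ _ _ _) cy (@cvg_cst _ _ _ _ _).
(* Where [D2] does not vanish, [0 = D1 (x - x0) + D2 (y - y0)] can be solved for [y - y0]. *)
have D20 : \forall t \near F, D2 t != 0 by exact: cvgr_neq0 c2 b0.
have cvgE : (fun t => - (D1 t * ((h t)^-1 * (x t - x0))) / D2 t) @ F --> - (a * s) / b.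
  apply: cvgM; last exact: cvgV.
  by apply: cvgN; apply: cvgM.
apply: cvg_trans cvgE; apply: near_eq_cvg.
apply: filterS2 fxy D20 => t ft D2t.
have := E t; rewrite ft f0 subrr => /esym/eqP; rewrite addr_eq0 => /eqP e.
have -> : y t - y0 = (- (D1 t * (x t - x0))) / D2 t.
  by rewrite e opprK mulrC mulKf.
by rewrite !mulNr !mulrN; congr (- _); rewrite mulrCA !mulrA.
Qed.

Lemma cvg_horner (p : {poly K}) (T : Type) (F : set_system T) {FF : Filter F}
    (y : T -> K) y0 : y @ F --> y0 -> (fun t => p.[y t]) @ F --> p.[y0].
Proof.
move=> cy; elim/poly_ind: p => [|p c IH].
  rewrite horner0 (_ : (fun t : T => _) = cst (0 : K)); first exact: cvg_cst.
  by apply/funext => t; rewrite horner0.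
rewrite !hornerE (_ : (fun t : T => _) = (fun t => p.[y t] * y t + c)); last first.
  by apply/funext => t; rewrite !hornerE.
by apply: cvgD; [exact: cvgM|exact: cvg_cst].
Qed.

(** With [x0] fixed, the factor [y - y0] cancels in the difference quotient and leaves [r], which is
    continuous. *)
Lemma sderiv_simple_root f x0 y0 a b (r : {poly K}) : sderiv f x0 y0 a b ->
  (forall y, f x0 y = (y - y0) * r.[y]) -> b = r.[y0].
Proof.
move=> fab fr.
have cy : id @ y0^' --> y0 by exact: nbhs_dnbhs.
have [D1 [D2 [c1 c2 E]]] := fab _ _ _ _ _ _ _ (@cvg_cst _ x0 _ _ _)
  (@cvg_cst _ x0 _ _ _) cy (@cvg_cst _ y0 _ _ _).
have cr : (fun y => r.[y]) @ y0^' --> r.[y0].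
  exact: cvg_horner.
have c2r : (fun y => r.[y]) @ y0^' --> b.
  apply: cvg_trans c2; apply: near_eq_cvg.
  have : \forall y \near y0^', y != y0 by exact: nbhs_dnbhs_neq.
  apply: filterS => y yy0; have := E y.
  rewrite !fr /= !subrr mulr0 mul0r subr0 add0r mulrC.
  by rewrite -subr_eq0 in yy0; move/(mulIf yy0) => ->.
exact: (cvg_unique (norm_hausdorff (V:=K)) c2r cr).
Qed.

End StrictDerivative.

(** * An implicit function theorem over the complex numbers *)

Section ImplicitFunction.
Local Open Scope classical_set_scope.
Variable R : realType.
Local Notation K := (R[i])^o.

(** The strict derivative is applied to the neighbourhood filter of [((x0, x0), (t0, t0))], with the
    four coordinate projections as curves. Convergence of the quotients then becomes a bound uniform
    on a ball. *)
Lemma sderiv_estimate (f : K -> K -> K) (x0 t0 c d : K) : c != 0 ->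
  @sderiv R[i] f x0 t0 c d ->
  exists2 e : R, 0 < e & forall x x' t t' : K,
    cabs (x - x0) < e -> cabs (x' - x0) < e ->
    cabs (t - t0) < e -> cabs (t' - t0) < e ->
    cabs (f x t - f x' t' - c * (x - x')) <=
      cabs c / 2 * cabs (x - x') + (cabs d + 1) * cabs (t - t').
Proof.
move=> c0 fcd.
pose F := nbhs ((x0, x0), (t0, t0)); have FF : Filter F := nbhs_filter _.
pose px (p : (K * K) * (K * K)) : K := p.1.1.
pose px' (p : (K * K) * (K * K)) : K := p.1.2.
pose pt (p : (K * K) * (K * K)) : K := p.2.1.
pose pt' (p : (K * K) * (K * K)) : K := p.2.2.
have [||||D1 [D2 [c1 c2 E]]] := fcd _ F _ px px' pt pt'.
- exact: (cvg_comp fst fst cvg_fst cvg_fst).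
- exact: (cvg_comp fst snd cvg_fst cvg_snd).
- exact: (cvg_comp snd fst cvg_snd cvg_fst).
- exact: (cvg_comp snd snd cvg_snd cvg_snd).
have c20 : 0 < cabs c / 2 by rewrite divr_gt0// cabs_gt0.
have n1 := (@cvg_cabsP R _ F FF D1 c).1 c1 _ c20.
have n2 := (@cvg_cabsP R _ F FF D2 d).1 c2 _ ltr01.
have /nbhs_ballP[e] : \forall p \near F,
    cabs (D1 p - c) < cabs c / 2 /\ cabs (D2 p - d) < 1.
  exact: filterI n1 n2.
rewrite /= ltcE => /andP[/eqP Ime Ree] be.
exists (complex.Re e) => // x x' t t' hx hx' ht ht'.
have eE : e = (complex.Re e)%:C by move: Ime; case: (e) => ? ? /= ->.
have [] := be ((x, x'), (t, t')).
  by split; split; rewrite /= -ball_normE /= normc_cabs eE ltcR cabsB.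
have := E ((x, x'), (t, t')); rewrite /px /px' /pt /pt' /= => -> h1 h2.
set d1 := D1 _ in h1 *; set d2 := D2 _ in h2 *.
rewrite (_ : _ - _ = (d1 - c) * (x - x') + d2 * (t - t')); last by ring.
apply: le_trans (cabsD _ _) _; rewrite !cabsM; apply: lerD.
  by rewrite ler_wpM2r ?cabs_ge0// ltW.
rewrite ler_wpM2r ?cabs_ge0// -(subrK d d2) addrC.
by apply: le_trans (cabsD _ _) _; rewrite lerD2l ltW.
Qed.

Lemma near_disc (c x : K) (r : R) :
  cabs (x - c) < r -> \forall x' \near x, cabs (x' - c) < r.
Proof.
have cx : (fun z : K => cabs (z - c)) @ nbhs x --> (cabs (x - c) : R).
  apply: (@cvg_cabs R K (nbhs x) _ (fun z => z - c)).
  by apply: cvgB; [exact: cvg_id|exact: cvg_cst].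
by move=> xr; exact: (cvgr_lt _ cx).
Qed.

(* For fixed [t], minimise [|f(., t)|] over a disc around [x0]; a Newton step from
   the minimiser stays in the disc and halves the value, so the minimum is [0].
   The estimate above makes the zero unique and Lipschitz in [t]. *)
Lemma implicit_function (f : K -> K -> K) (x0 t0 c d : K) : c != 0 ->
  @sderiv R[i] f x0 t0 c d -> f x0 t0 = 0 ->
  exists2 g : K -> K, g t0 = x0 &
    \forall t \near t0, f (g t) t = 0 /\ {for t, continuous g}.
Proof.
move=> c0 fcd f0; have [e e0 est] := sderiv_estimate c0 fcd.
set M := cabs d + 1 in est; set k := cabs c in est.
have k0 : 0 < k by rewrite cabs_gt0.
have M0 : 0 < M by rewrite ltr_wpDl ?cabs_ge0.
pose r := e / 2; have r0 : 0 < r by rewrite divr_gt0.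
have re : r < e by rewrite /r; lra.
(* The minimiser [p] will satisfy [k * cabs (p - x0) <= 4 * M * cabs (t - t0)], and the Newton step
   adds at most [M * cabs (t - t0)]. The factor [5] keeps the sum below [r * k]. *)
pose eta := Num.min e (r * k / (5 * M)).
have eta0 : 0 < eta by rewrite lt_min e0 divr_gt0 ?mulr_gt0.
have lip (x x' t t' : K) : cabs (x - x0) < e -> cabs (x' - x0) < e ->
    cabs (t - t0) < e -> cabs (t' - t0) < e ->
    k / 2 * cabs (x - x') <= cabs (f x t - f x' t') + M * cabs (t - t').
  move=> hx hx' ht ht'; have := est _ _ _ _ hx hx' ht ht'.
  have := cabsD (f x t - f x' t') (- (f x t - f x' t' - c * (x - x'))).
  rewrite cabsN opprB addrC subrK cabsM -/k => h1 h2.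
  lra.
have x0e : cabs (x0 - x0) < e by rewrite subrr cabs0.
have t0e : cabs (t0 - t0) < e by rewrite subrr cabs0.
have ex (t : K) : cabs (t - t0) < eta -> exists2 x, cabs (x - x0) <= r & f x t = 0.
  rewrite lt_min => /andP[te].
  rewrite ltr_pdivlMr ?mulr_gt0// => teta.
  pose D := [set z : K | cabs (z - x0) <= r].
  have [||p /set_mem pD pmin] :=
    @compact_EVT_min K R (fun x => cabs (f x t)) D _ (@compact_disc R x0 r).
  - by exists x0; rewrite /D /= subrr cabs0 ltW.
  - apply: continuous_in_subspaceT => x /set_mem xD.
    have xe : cabs (x - x0) < e := le_lt_trans xD re.
    apply: (@cvg_cabs R K (nbhs x) _ (f ^~ t) (f x t)).
    apply/cvg_cabsP => s s0.
    have xn1 := near_disc xe.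
    (* For fixed [t] the estimate gives the Lipschitz constant [3 / 2 * k], so this radius
       suffices. *)
    have xn2 : \forall x' \near x, cabs (x' - x) < s / (k * 2).
      by apply: near_disc; rewrite subrr cabs0 divr_gt0 ?mulr_gt0.
    apply: filterS2 xn1 xn2 => x' h1.
    rewrite ltr_pdivlMr ?mulr_gt0// => h2.
    have := est _ _ _ _ h1 xe te te; rewrite subrr cabs0 mulr0 addr0 => h3.
    rewrite -(subrK (c * (x' - x)) (_ - _)).
    apply: le_lt_trans (cabsD _ _) _; rewrite cabsM -/k.
    have := cabs_ge0 (x' - x); nra.
  exists p => //; apply/eqP; rewrite -cabs_eq0; set N := cabs (f p t) in pmin *.
  have pe : cabs (p - x0) < e := le_lt_trans pD re.
  pose q := p - f p t / c.
  have fpM : cabs (f x0 t) <= M * cabs (t - t0).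
    have := est _ _ _ _ x0e x0e te t0e.
    by rewrite f0 !subrr subr0 mulr0 subr0 cabs0 mulr0 add0r.
  have NM : N <= M * cabs (t - t0).
    apply: le_trans fpM; apply: pmin; apply/mem_set.
    by rewrite /D /= subrr cabs0 ltW.
  have h1 : k / 2 * cabs (p - x0) <= 2 * (M * cabs (t - t0)).
    have := lip _ _ _ _ pe x0e te te; rewrite subrr cabs0 mulr0 addr0.
    have := cabsD (f p t) (- f x0 t); rewrite cabsN -/N => h1 h2.
    lra.
  have qp : cabs (q - p) * k = N.
    by rewrite /q addrAC subrr add0r cabsN /k -cabsM mulfVK.
  have qr : cabs (q - x0) <= r.
    have := cabsD (q - p) (p - x0); rewrite addrA subrK => h2.
    rewrite -(ler_pM2r k0); nra.
  (* The linear part of the step cancels [f p t], so [cabs (f q t) <= k / 2 * cabs (q - p) = N / 2].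
     Minimality gives [N <= N / 2], hence [N = 0]. *)
  have := est _ _ _ _ (le_lt_trans qr re) pe te te.
  have cqp : c * (q - p) = - f p t.
    by rewrite /q addrAC subrr add0r mulrN mulrCA mulfV// mulr1.
  rewrite cqp opprK subrK subrr cabs0 mulr0 addr0 => h2.
  have := pmin q (mem_set qr) => h3.
  have := cabs_ge0 (f p t); rewrite -/N => h4.
  apply/eqP; nra.
(* Within [eta] of [t0] a zero exists, so the default [x0] is not taken there. *)
pose g (t : K) : K := xget x0 [set x : K | cabs (x - x0) <= r /\ f x t = 0].
have gP (t : K) : cabs (t - t0) < eta -> cabs (g t - x0) <= r /\ f (g t) t = 0.
  move=> /ex[x xr fx]; rewrite /g.
  by case: xgetP => [y _ //|/(_ x)[]].
have ge (t : K) : cabs (t - t0) < eta -> cabs (g t - x0) < e.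
  by move=> /gP[h _]; exact: le_lt_trans re.
have etae (t : K) : cabs (t - t0) < eta -> cabs (t - t0) < e.
  by rewrite lt_min => /andP[].
have t0eta : cabs (t0 - t0) < eta by rewrite subrr cabs0.
exists g.
  have := lip _ _ _ _ (ge _ t0eta) x0e t0e t0e.
  rewrite (gP _ t0eta).2 f0 subrr cabs0 subrr cabs0 mulr0 addr0 => h.
  apply/eqP; rewrite -subr_eq0 -cabs_eq0; apply/eqP.
  have := cabs_ge0 (g t0 - x0); nra.
apply: filterS (near_disc t0eta) => t teta.
split; first exact: (gP _ teta).2.
apply/(@cvg_cabsP R K (nbhs t) _ g (g t)) => s s0.
have n2 : \forall t' \near t, cabs (t' - t) < s * k / (2 * M).
  by apply: near_disc; rewrite subrr cabs0 divr_gt0 ?mulr_gt0.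
apply: filterS2 (near_disc teta) n2 => t' t'eta.
rewrite ltr_pdivlMr ?mulr_gt0// => h1.
have := lip _ _ _ _ (ge _ t'eta) (ge _ teta) (etae _ t'eta) (etae _ teta).
rewrite (gP _ t'eta).2 (gP _ teta).2 subrr cabs0 add0r => h2.
rewrite -(ltr_pM2r k0); lra.
Qed.

End ImplicitFunction.

(** * Chain rule for the exponential, and limits of roots near the unit circle *)

Section ComplexLimits.
Local Open Scope classical_set_scope.
Variable R : realType.
Local Notation K := (R[i])^o.

(** This is the chain rule: [exp(- l t)] has the partial derivatives [- t y] and [- l y]. The
    increment of the exponent is split as [- (x - x') y - x' (y - y')]. *)
Lemma sderiv_cexp (f : K -> K -> K) (l0 t0 y0 a b : K) :
  @sderiv R[i] f l0 y0 a b -> y0 = cexp (- (l0 * t0)) ->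
  @sderiv R[i] (fun l t => f l (cexp (- (l * t)))) l0 t0
    (a - t0 * y0 * b) (- (l0 * y0 * b)).
Proof.
move=> fab y0E T F FF x x' y y' cx cx' cy cy'.
have cE : (fun t => cexp (- (x t * y t)) : K) @ F --> (y0 : K).
  by rewrite y0E; apply: cvg_cexp; exact: (cvgN (cvgM cx cy)).
have cE' : (fun t => cexp (- (x' t * y' t)) : K) @ F --> (y0 : K).
  by rewrite y0E; apply: cvg_cexp; exact: (cvgN (cvgM cx' cy')).
have [D1 [D2 [c1 c2 E]]] := fab _ _ _ _ _ _ _ cx cx' cE cE'.
pose u t : K := x' t * y' t - x t * y t.
have cu : (fun t => cexp_slope (u t) : K) @ F --> (1 : K).
  apply: cvg_cexp_slope; rewrite -(subrr (l0 * t0)).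
  exact: (cvgB (cvgM cx' cy') (cvgM cx cy)).
have cw : (fun t => D2 t * cexp (- (x' t * y' t)) * cexp_slope (u t) : K) @ F -->
    (b * y0 * 1 : K).
  exact: (cvgM (cvgM c2 cE') cu).
exists (fun t => D1 t - D2 t * cexp (- (x' t * y' t)) * cexp_slope (u t) * y t).
exists (fun t => - (D2 t * cexp (- (x' t * y' t)) * cexp_slope (u t) * x' t)).
split.
- rewrite [X in _ --> X](_ : _ = a - b * y0 * 1 * t0); last by ring.
  exact: (cvgB c1 (cvgM cw cy)).
- rewrite [X in _ --> X](_ : _ = - (b * y0 * 1 * l0)); last by ring.
  exact: (cvgN (cvgM cw cx')).
- move=> t; rewrite E.
  have -> : cexp (- (x t * y t)) - cexp (- (x' t * y' t)) =
      cexp (- (x' t * y' t)) * (cexp_slope (u t) * u t).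
    rewrite -cexp_slopeE mulrBr mulr1 -cexpD /u; congr (cexp _ - _); ring.
  rewrite /u; ring.
Qed.

(* Compactness: away from [y0], no point of the disc is close to being both a
   root of [f x0] and of modulus [1]. *)
Lemma unit_root_cvg (f : K -> K -> K) (x0 y0 : K) (T : Type) (F : set_system T)
    {FF : Filter F} (x y : T -> K) :
  (forall z, @sderivable R[i] f x0 z) ->
  (forall z, cabs z = 1 -> f x0 z = 0 -> z = y0) ->
  x @ F --> x0 -> (\forall t \near F, f (x t) (y t) = 0) ->
  (fun t => cabs (y t)) @ F --> (1 : R) -> y @ F --> y0.
Proof.
move=> df uniq0 cx fxy cy; apply/cvg_cabsP => e e0.
(* The point [z = y t] violates the first alternative as soon as [f (x t) (y t) = 0], so [P t (y t)]
   yields the desired bound. The disc of radius [2] eventually contains [y t], whose modulus tends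
   to [1]. *)
pose P t z := ~ (f (x t) z = 0 /\ cabs z = cabs (y t)) \/ cabs (z - y0) < e.
have cP : \forall t \near F, [set z : K | cabs (z - 0) <= 2] `<=` P t.
  have /compact_near_coveringP := @compact_disc R 0 2.
  apply=> z0 _; have [z zE] : exists z : K, z = z0 by exists z0.
  rewrite -{z0}zE.
  suff : \forall p \near filter_prod (nbhs z) F, P p.2 p.1 by [].
  have czt : (fun p : K * T => cabs (y p.2)) @ filter_prod (nbhs z) F --> (1 : R).
    by apply: cvg_comp cy; exact: cvg_snd.
  have czz : (fun p : K * T => cabs p.1) @ filter_prod (nbhs z) F --> (cabs z : R).
    by apply: cvg_cabs; exact: cvg_fst.
  (* Three cases: [z] is close to [y0]; [z] is on the unit circle but not a root of [f x0]; [z] is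
     off the unit circle. Each condition persists nearby. *)
  have [ze|ze] := ltP (cabs (z - y0)) e.
    exists ([set z' | cabs (z' - y0) < e], setT).
      by split; [exact: near_disc|exact: filterT].
    by move=> [z' t] [/= h _]; right.
  have [z1|z1] := eqVneq (cabs z) 1.
    have fz0 : f x0 z != 0.
      apply/eqP => fz; have zy := uniq0 _ z1 fz.
      by move: ze; rewrite zy subrr cabs0 leNgt e0.
    have [a [b fab]] := df z.
    have cf : (fun p : K * T => f (x p.2) p.1) @ filter_prod (nbhs z) F --> f x0 z.
      apply: (sderiv_cvg fab); last exact: cvg_fst.
      by apply: cvg_comp cx; exact: cvg_snd.
    have : \forall p \near filter_prod (nbhs z) F, f (x p.2) p.1 != 0.
      exact: (cvgr_neq0 _ cf fz0).
    by apply: filterS => -[z' t] /= /eqP h; left => -[].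
  have cd : (fun p : K * T => cabs p.1 - cabs (y p.2)) @ filter_prod (nbhs z) F -->
      (cabs z - 1 : R) by exact: cvgB.
  have zn0 : cabs z - 1 != 0 by rewrite subr_eq0.
  have : \forall p \near filter_prod (nbhs z) F, cabs p.1 - cabs (y p.2) != 0.
    exact: (cvgr_neq0 _ cd zn0).
  by apply: filterS => -[z' t] /=; rewrite subr_eq0 => /eqP h; left => -[].
have lt12 : (1 : R) < 2 by rewrite ltr1n.
have y2 : \forall t \near F, cabs (y t) < 2 by exact: (cvgr_lt _ cy).
apply: filterS (filterI (filterI cP y2) fxy) => t [[Pt /ltW yt] ft].
by case: (Pt (y t)); rewrite /= ?subr0// => -[].
Qed.

(** The difference of the squared moduli of [u] and [v] is the real part of
    [(u - v) * (u + v)^*]. *)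
Lemma cabs_sqr_slope (y : R -> K) (y0 s : K) :
  y @ 0^' --> y0 ->
  (fun h : R => (h%:C)^-1 * (y h - y0) : K) @ 0^' --> s ->
  (fun h : R => h^-1 * (cabs (y h) ^+ 2 - cabs y0 ^+ 2)) @ 0^' -->
    (2 * complex.Re (s * y0^*) : R).
Proof.
move=> cy cs.
have cyj : (fun h => (y h + y0)^* : K) @ 0^' --> ((y0 + y0)^* : K).
  have /cvg_complexP[cr ci] : (fun h => y h + y0 : K) @ 0^' --> (y0 + y0 : K).
    by apply: cvgD; [exact: cy|exact: cvg_cst].
  apply/cvg_complexP; split.
    rewrite (_ : (fun t : R => _) = (fun t => complex.Re (y t + y0))).
      by rewrite [X in _ --> X](_ : _ = complex.Re (y0 + y0)) //; case: (y0 + y0).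
    by apply/funext => t; case: (y t + y0).
  rewrite (_ : (fun t : R => _) = (fun t => - complex.Im (y t + y0))).
    rewrite [X in _ --> X](_ : _ = - complex.Im (y0 + y0)); last by case: (y0 + y0).
    exact: cvgN.
  by apply/funext => t; case: (y t + y0).
have cM : (fun h : R => (h%:C)^-1 * (y h - y0) * (y h + y0)^* : K) @ 0^' -->
    (s * (y0 + y0)^* : K) by exact: (cvgM cs cyj).
have /cvg_complexP[+ _] := cM.
rewrite [X in _ --> X -> _](_ : _ = 2 * complex.Re (s * y0^*)); last first.
  rewrite rmorphD mulrDr ReD; ring.
apply: cvg_trans; apply: near_eq_cvg; apply: nearW => h /=.
rewrite -mulrA !cabs_sqr -[_^-1](fmorphV (real_complex R)).
case: (y h) => a b; case: (y0) => c d /=; ring.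
Qed.

End ComplexLimits.

(** The integers below [size p] are too many to be all roots of [p]. *)
Lemma poly_nonroot (F : numDomainType) (p : {poly F}) : p != 0 -> exists y, p.[y] != 0.
Proof.
move=> p0; apply: contrapT => nex.
pose rs := [seq (k%:R : F) | k <- iota 0 (size p)].
have : (size rs < size p)%N.
  apply: max_poly_roots => //.
    apply/allP => y _; apply/negP => ry; apply: nex; exists y.
    by apply/negP => py; apply: ry.
  by rewrite map_inj_uniq ?iota_uniq// => k l /eqP; rewrite eqr_nat => /eqP.
by rewrite size_map size_iota ltnn.
Qed.

(** * The characteristic function of two variables and degenerate frequencies *)

Section CharacteristicFunction.
Local Open Scope classical_set_scope.
Variables (R : realType) (n : nat) (A B : 'M[R]_n).
Local Notation K := (R[i])^o.

Definition charf (x y : R[i]) : R[i] := \det (x%:M - cmx A - y *: cmx B).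

Lemma gen_poly_horner w y : (gen_poly A B w).[y] = charf (0 +i* w) y.
Proof.
rewrite /gen_poly -horner_evalE -det_map_mx; congr (\det _).
apply/matrixP => i j; rewrite !mxE /=.
by rewrite /horner_eval !hornerD !hornerN hornerM hornerMn !hornerC hornerX.
Qed.

(** The matrices are real. This supplies the conjugate half of a family of roots. *)
Lemma charf_conjc x y : charf x^* y^* = (charf x y)^*.
Proof.
rewrite /charf -det_map_mx; congr (\det _).
apply/matrixP => i j; rewrite !mxE !rmorphB rmorphM rmorphMn /=.
by rewrite !oppr0.
Qed.

Lemma sderivable_charf x y : @sderivable R[i] charf x y.
Proof.
apply: sderivable_det => i j.
pose g (u v : R[i]) := u * (i == j)%:R + (- (cmx A i j) + v * (- cmx B i j)).
apply: (@sderivable_ext _ g) => [u v|].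
  by rewrite /g !mxE mulrN addrA mulr_natr.
apply: sderivableD.
  apply: sderivableM; [exact: sderivable_fst|exact: sderivable_cst].
apply: sderivableD; first exact: sderivable_cst.
by apply: sderivableM; [exact: sderivable_snd|exact: sderivable_cst].
Qed.

Lemma degenerate_const w : degenerate A B w ->
  forall y, charf (0 +i* w) y = charf (0 +i* w) 0.
Proof. by move=> dw y; rewrite -!gen_poly_horner dw !hornerC. Qed.

(** A zero polynomial is constant and equals its value at [0], which is the degenerate case. *)
Lemma gen_poly_neq0 w : ~ degenerate A B w -> gen_poly A B w != 0.
Proof.
move=> nd; apply/eqP => p0; apply: nd; rewrite /degenerate p0.
have := gen_poly_horner w 0; rewrite p0 horner0 /charf scale0r subr0 => <-.
by rewrite polyC0.
Qed.

(** A single [y] at which the polynomial differs from its value at [0] witnesses nondegeneracy, and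
    by continuity the same [y] works for nearby frequencies. *)
Lemma near_nondegenerate w : ~ degenerate A B w ->
  \forall v \near w, ~ degenerate A B v.
Proof.
move=> nd.
have [y] : exists y, (gen_poly A B w - (\det ((0 +i* w)%:M - cmx A))%:P).[y] != 0.
  by apply: poly_nonroot; rewrite subr_eq0; apply/eqP.
rewrite hornerD hornerN hornerC gen_poly_horner.
have -> : \det ((0 +i* w)%:M - cmx A) = charf (0 +i* w) 0.
  by rewrite /charf scale0r subr0.
move=> yn0.
have cx : (fun v : R => 0 +i* v : K) @ w --> (0 +i* w : K).
  by apply/cvg_complexP; split => /=; [exact: cvg_cst|exact: cvg_id].
have cf z : (fun v : R => charf (0 +i* v) z : K) @ w --> (charf (0 +i* w) z : K).
  have [a [b fab]] := sderivable_charf (0 +i* w) z.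
  by apply: (sderiv_cvg fab cx); exact: cvg_cst.
have : \forall v \near w, charf (0 +i* v) y - charf (0 +i* v) 0 != 0.
  exact: (cvgr_neq0 _ (cvgB (cf y) (cf 0)) yn0).
by apply: filterS => v + /degenerate_const dv; rewrite /= dv subrr eqxx.
Qed.

End CharacteristicFunction.

(** * From values of gamma to moduli of roots *)

Section SpectrumBranch.
Local Open Scope classical_set_scope.
Variable R : realType.

Local Notation K := (R[i])^o.

Lemma acs_gamma_eq0 (y : option R[i]) : acs_gamma y = 0%E ->
  exists2 z, y = Some z & cabs z = 1.
Proof.
case: y => [z|]; rewrite /acs_gamma; last by [].
move=> /eqP; rewrite oppe_eq0 lne_eq0 => /eqP[z1].
by exists z.
Qed.

Lemma acs_gamma_unit (z : R[i]) : cabs z = 1 -> acs_gamma (Some z) = 0%E.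
Proof. by move=> z1; rewrite /acs_gamma z1 lne1 oppe0. Qed.

(** Since [fine] sends both infinities to [0], a nonzero value excludes the roots [0] and
    infinity. *)
Lemma acs_gamma_fine_neq0 (y : option R[i]) : fine (acs_gamma y) != 0 ->
  exists2 z, y = Some z & cabs z = expR (- fine (acs_gamma y)).
Proof.
case: y => [z|]; rewrite /acs_gamma; last by rewrite /= eqxx.
have [z0|z0] := ltP 0 (cabs z).
  by rewrite lne_EFin//= => _; exists z; rewrite ?opprK ?lnK ?posrE.
by rewrite le0_lneNy ?lee_fin//= eqxx.
Qed.

End SpectrumBranch.

(** * Branch slopes, crossing delays and root families in class II *)

Section ClassII.
Local Open Scope classical_set_scope.
Variables (R : realType) (n : nat) (A B : 'M[R]_n) (m : nat).
Variables (Y : 'I_m -> R -> option R[i]) (j h : 'I_m) (w1 w2 : R).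
Hypothesis rootsY : gen_roots A B Y.
Hypothesis classII : universality_class_II A B Y j h w1 w2.
Local Notation K := (R[i])^o.
Local Notation f := (charf A B).

Lemma charf_prod w y : ~ degenerate A B w ->
  f (0 +i* w) y = lead_coef (gen_poly A B w) *
    \prod_(l < m) (if Y l w is Some z then 'X - z%:P else 1).[y].
Proof.
by move=> nd; rewrite -gen_poly_horner [in LHS](rootsY nd) hornerZ horner_prod.
Qed.

(** The leading coefficient is nonzero, and a root at infinity contributes the factor [1], which
    never vanishes. *)
Lemma charf_eq0P w y : ~ degenerate A B w ->
  f (0 +i* w) y = 0 <-> exists l, Y l w = Some y.
Proof.
move=> nd; rewrite charf_prod//; split.
  move=> /eqP; rewrite mulf_eq0 lead_coef_eq0 (negbTE (gen_poly_neq0 nd)) /=.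
  move=> /prodf_eq0[l _]; case lE: (Y l w) => [z|].
    by rewrite !hornerE subr_eq0 => /eqP ->; exists l.
  by rewrite hornerE oner_eq0.
move=> [l lE]; apply/eqP; rewrite mulf_eq0; apply/orP; right.
by apply/prodf_eq0; exists l => //; rewrite lE !hornerE subrr.
Qed.

Lemma freq_gt0 w : w \in [:: w1; w2] -> 0 < w.
Proof.
have /andP[w20 w21] := classII_freq classII.
by rewrite !inE => /orP[] /eqP-> //; exact: lt_trans w21.
Qed.

(* A root on the unit circle is a point of the spectrum with gamma = 0, which
   condition (iv) confines to the frequencies of the class. *)
Lemma unit_root w z : ~ degenerate A B w -> cabs z = 1 -> f (0 +i* w) z = 0 ->
  (w \in [:: w1; w2] /\ Y j w = Some z) \/ (- w \in [:: w1; w2]).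
Proof.
move=> nd z1 /(charf_eq0P _ nd)[l lE].
have g0 : acs_branch Y l w = 0%E by rewrite /acs_branch lE acs_gamma_unit.
(* On the closed interval of branch [j] the interior has positive gamma, so only the endpoints
   remain; branch [h] is treated likewise on the mirrored interval. *)
have [/andP[/eqP lj /andP[hw2 hw1]]|nj] := boolP ((l == j) && (w2 <= w <= w1)).
  left; split; last by rewrite -lj.
  move: hw2 hw1; rewrite !inE !le_eqVlt eq_sym => /orP[->|hw2]; first by rewrite orbT.
  move=> /orP[->//|hw1].
  have := classII_gt0_pos classII; move=> /(_ w); rewrite hw2 hw1 => /(_ isT nd).
  by rewrite -lj g0 ltxx.
have [/andP[/eqP lh /andP[hw2 hw1]]|nh] := boolP ((l == h) && (- w1 <= w <= - w2)).
  right; move: hw2 hw1; rewrite !inE eqr_oppLR (eqr_oppLR w w2) !le_eqVlt.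
  rewrite (eq_sym (- w1)) => /orP[->//|hw2].
  move=> /orP[->|hw1]; first by rewrite orbT.
  have := classII_gt0_neg classII; move=> /(_ w); rewrite hw2 hw1 => /(_ isT nd).
  by rewrite -lh g0 ltxx.
have := classII_remaining classII nd nj nh.
by rewrite g0 ltxx.
Qed.

Lemma unit_root_freq w z : w \in [:: w1; w2] -> cabs z = 1 ->
  f (0 +i* w) z = 0 -> Y j w = Some z.
Proof.
move=> wH z1 fz; have [nd _] := classII_zero_pos classII wH.
have [[]//|nw] := unit_root nd z1 fz.
by have := freq_gt0 nw; rewrite oppr_gt0 ltNge ltW// freq_gt0.
Qed.

Lemma branch_unit w : w \in [:: w1; w2] ->
  exists z, [/\ Y j w = Some z, cabs z = 1 & f (0 +i* w) z = 0].
Proof.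
move=> wH; have [nd] := classII_zero_pos classII wH.
move=> /acs_gamma_eq0[z zE z1]; exists z; split => //.
by apply/(charf_eq0P _ nd); exists j.
Qed.

(** Here [b] is the value at [z] of the generating polynomial divided by [Y - z]. Another branch
    through [z] would have gamma equal to [0] at a positive frequency, against condition (iv), whose
    exception for [h] concerns negative frequencies only. *)
Lemma branch_simple w z a b : w \in [:: w1; w2] -> Y j w = Some z -> cabs z = 1 ->
  @sderiv R[i] f (0 +i* w) z a b -> b != 0.
Proof.
move=> wH zE z1 fab; have [nd _] := classII_zero_pos classII wH.
pose r : {poly R[i]} := lead_coef (gen_poly A B w) *:
  \prod_(l < m | l != j) (if Y l w is Some y then 'X - y%:P else 1).
have fr y : f (0 +i* w) y = (y - z) * r.[y].
  by rewrite charf_prod// (bigD1 j)//= zE hornerXsubC hornerZ horner_prod mulrCA.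
rewrite (sderiv_simple_root fab fr) hornerZ horner_prod mulf_neq0//.
  by rewrite lead_coef_eq0 gen_poly_neq0.
apply/prodf_neq0 => l lj; case e: (Y l w) => [y|]; last first.
  by rewrite hornerE oner_eq0.
rewrite !hornerE subr_eq0; apply/eqP => zy.
have := classII_remaining classII nd (l := l); rewrite (negbTE lj) /acs_branch e -zy.
rewrite acs_gamma_unit// ltxx => /(_ isT) H; apply: notF; apply: H.
apply/negP => /andP[_ /andP[_]]; apply/negP; rewrite -ltNge.
have /andP[w20 _] := classII_freq classII.
by apply: lt_trans (freq_gt0 wH); rewrite oppr_lt0.
Qed.

Lemma branch_quotient w : w \in [:: w1; w2] ->
  (fun e : R => e^-1 * fine (acs_branch Y j (e + w))) @ 0^' -->
  derive1 (fine \o acs_branch Y j) w.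
Proof.
move=> wH; have [_ g0] := classII_zero_pos classII wH.
have [[dg _] _] := classII_regular classII wH.
rewrite (_ : (fun e : R => _) =
  (fun e => e^-1 *: ((fine \o acs_branch Y j) (e + w) - (fine \o acs_branch Y j) w))).
  rewrite derive1E; have := dg; rewrite /derivable /derive.
  rewrite (_ : (fun e => _ *: (_ (_ *: 1) - _)) =
    (fun e => e^-1 *: ((fine \o acs_branch Y j) (e + w) - (fine \o acs_branch Y j) w))) //.
  by apply/funext => e; rewrite /= [e%:A]mulr1.
by apply/funext => e; rewrite /= g0 subr0.
Qed.

Lemma branch_slope w z a b : w \in [:: w1; w2] -> Y j w = Some z -> cabs z = 1 ->
  @sderiv R[i] f (0 +i* w) z a b ->
  derive1 (fine \o acs_branch Y j) w = - complex.Im (a / (b * z)).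
Proof.
move=> wH zE z1 fab; have b0 := branch_simple wH zE z1 fab.
have [nd _] := classII_zero_pos classII wH.
have cq := branch_quotient wH.
set g' := derive1 _ _ in cq *.
have g'0 : g' != 0 by have [[]] := classII_regular classII wH.
pose g e := fine (acs_branch Y j (e + w)).
(* A nonzero slope keeps gamma away from [0] in a punctured neighbourhood, where [Y j] is therefore
   finite and nonzero. *)
have gn0 : \forall e \near (0 : R)^', g e != 0.
  have : \forall e \near (0 : R)^', e^-1 * g e != 0 by exact: (cvgr_neq0 _ cq g'0).
  by apply: filterS => e; rewrite mulf_eq0 negb_or => /andP[].
have cid : (id : R -> R) @ (0 : R)^' --> (0 : R) by exact: nbhs_dnbhs.
have nn0 : \forall e \near (0 : R)^', e != 0 by exact: nbhs_dnbhs_neq.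
have cg : g @ (0 : R)^' --> (0 : R).
  rewrite -[X in _ --> X](mul0r g').
  apply: cvg_trans (cvgM cid cq); apply: near_eq_cvg.
  by apply: filterS nn0 => e e0 /=; rewrite mulVKf.
pose y e : K := odflt 0 (Y j (e + w)).
have yP : \forall e \near (0 : R)^',
    Y j (e + w) = Some (y e) /\ cabs (y e) = expR (- g e).
  by apply: filterS gn0 => e /acs_gamma_fine_neq0[u uE uc]; rewrite /y uE.
have ndn : \forall e \near (0 : R)^', ~ degenerate A B (e + w).
  exact: near0_shift (near_nondegenerate nd).
have fy : \forall e \near (0 : R)^', f (0 +i* (e + w)) (y e) = 0.
  by apply: filterS2 yP ndn => e [ye _] nde; apply/(charf_eq0P _ nde); exists j.
have cx : (fun e : R => 0 +i* (e + w) : K) @ (0 : R)^' --> (0 +i* w : K).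
  apply/cvg_complexP; split => /=; first exact: cvg_cst.
  by rewrite -[X in _ --> X]add0r; apply: cvgD; [exact: cid|exact: cvg_cst].
have cexpg : (fun e => expR (- g e)) @ (0 : R)^' --> (1 : R).
  have cNg : (fun e => - g e) @ (0 : R)^' --> (0 : R).
    by rewrite -[X in _ --> X]oppr0; exact: cvgN.
  by rewrite -[X in _ --> X]expR0; apply: cvg_comp cNg _; exact: continuous_expR.
have cay : (fun e => cabs (y e)) @ (0 : R)^' --> (1 : R).
  apply: cvg_trans cexpg; apply: near_eq_cvg.
  by apply: filterS yP => e [_ ->].
(* Continuity of [Y j] at [w] is derived: its moduli tend to [1], and [z] is the only root of
   modulus [1] at [w]. *)
have cy : y @ (0 : R)^' --> (z : K).
  apply: (@unit_root_cvg R f (0 +i* w) z _ _ _ (fun e => 0 +i* (e + w))) => //.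
    by move=> u; exact: sderivable_charf.
  by move=> u u1 fu; have := unit_root_freq wH u1 fu; rewrite zE => -[].
have fz : f (0 +i* w) z = 0 by apply/(charf_eq0P _ nd); exists j.
have cs : (fun e : R => (e%:C)^-1 * ((0 +i* (e + w)) - (0 +i* w)) : K) @ (0 : R)^' -->
    ('i : K).
  apply: cvg_trans (@cvg_cst K ('i : K) R (0 : R)^' _); apply: near_eq_cvg.
  apply: filterS nn0 => e e0 /=.
  rewrite -(mulKf (_ : e%:C != 0) 'i); last by rewrite eq_complex /= eqxx andbT.
  by congr (_ * _); simpc; rewrite /= addrK.
have cys := sderiv_implicit (FF := dnbhs_filter (0 : R)) fab b0 fz cx cy fy cs.
have csq := cabs_sqr_slope cy cys.
have cexpg' : (fun e => e^-1 * (cabs (y e) ^+ 2 - cabs z ^+ 2)) @ (0 : R)^' --> - 2 * g'.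
  have ce : (fun e => slope0 expR 1 (- 2 * g e) * (- 2 * (e^-1 * g e))) @ (0 : R)^' -->
      1 * (- 2 * g').
    apply: cvgM; last by apply: cvgM; [exact: cvg_cst|exact: cq].
    have c2g : (fun e => - 2 * g e) @ (0 : R)^' --> (0 : R).
      by rewrite -[X in _ --> X](mulr0 (- 2)); apply: cvgM; [exact: cvg_cst|exact: cg].
    apply: cvg_comp c2g _; apply: cvg_slope0.
    by rewrite -[X in is_derive _ _ _ X]expR0; exact: is_derive_expR.
  rewrite mul1r in ce; apply: cvg_trans ce; apply: near_eq_cvg.
  apply: filterS yP => e [_ ->]; rewrite z1 expr1n -expRM_natl mulrN mulNr.
  have := slope0E expR 1 (- (2 * g e)); rewrite expR0 => ->; ring.
have gE : - 2 * g' = 2 * complex.Re (- (a * 'i) / b * conjc z).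
  exact: (cvg_unique (@norm_hausdorff _ R^o) cexpg' csq).
have zJ : conjc z = z^-1.
  have z0 : z != 0 by rewrite -cabs_gt0 z1.
  by apply: (mulfI z0); rewrite mulfV// -sqr_normc normc_cabs z1 expr1n.
have -> : g' = - complex.Re (- (a * 'i) / b * conjc z) by lra.
rewrite zJ invfM; case: (a) (b^-1) (z^-1) => ? ? [? ?] [? ?] /=; ring.
Qed.

(** To the left of [w1] the quotient of a positive gamma by a negative increment is at most [0],
    also when gamma is infinite and [fine] returns [0]. Regularity excludes a zero limit. At [w2]
    the increments are taken to the right. *)
Lemma slope_w1 : derive1 (fine \o acs_branch Y j) w1 < 0.
Proof.
have w1H : w1 \in [:: w1; w2] by rewrite inE eqxx.
have [nd _] := classII_zero_pos classII w1H.
have [[_ g'0] _] := classII_regular classII w1H.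
have /andP[w20 w21] := classII_freq classII.
rewrite lt_neqAle g'0 /=.
have cql := cvg_dnbhs_at_left (branch_quotient w1H).
apply: (cvgr_to_le cql); rewrite near_withinE.
have ndn := near0_shift (near_nondegenerate nd).
have wn : \forall e \near (0 : R)^', w2 < e + w1.
  by apply: (near0_shift (P := fun v => w2 < v)); exact: lt_nbhsr.
rewrite /dnbhs near_withinE in ndn; rewrite /dnbhs near_withinE in wn.
apply: filterS2 ndn wn => e + + e0; rewrite lt_eqF// => /(_ isT) nde /(_ isT) we.
rewrite nmulr_rle0 ?invr_lt0//; apply: fine_ge0; apply: ltW.
by apply: (classII_gt0_pos classII) => //; rewrite we /= gtrDr.
Qed.

Lemma slope_w2 : 0 < derive1 (fine \o acs_branch Y j) w2.
Proof.
have w2H : w2 \in [:: w1; w2] by rewrite !inE eqxx orbT.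
have [nd _] := classII_zero_pos classII w2H.
have [[_ g'0] _] := classII_regular classII w2H.
have /andP[w20 w21] := classII_freq classII.
rewrite lt_neqAle eq_sym g'0 /=.
have cqr := cvg_dnbhs_at_right (branch_quotient w2H).
apply: (cvgr_to_ge cqr); rewrite near_withinE.
have ndn := near0_shift (near_nondegenerate nd).
have wn : \forall e \near (0 : R)^', e + w2 < w1.
  by apply: (near0_shift (P := fun v => v < w1)); exact: lt_nbhsl.
rewrite /dnbhs near_withinE in ndn; rewrite /dnbhs near_withinE in wn.
apply: filterS2 ndn wn => e + + e0; rewrite gt_eqF// => /(_ isT) nde /(_ isT) we.
rewrite pmulr_rge0 ?invr_gt0//; apply: fine_ge0; apply: ltW.
by apply: (classII_gt0_pos classII) => //; rewrite we /= ltrDr e0.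
Qed.

(** By definition [w * tau = - carg z + 2 * pi * k], and the multiple of [2 * pi] disappears in the
    exponential. *)
Lemma crossing_delay_root w k : w \in [:: w1; w2] ->
  exists z, [/\ Y j w = Some z, cabs z = 1, f (0 +i* w) z = 0 &
    z = cexp (- ((0 +i* w) * (crossing_delay Y j w k)%:C))].
Proof.
move=> wH; have [z [zE z1 fz]] := branch_unit wH; exists z; split=> //.
rewrite (_ : - _ = (0 +i* carg z) + (0 +i* (2 * pi * (- k%:Z)%:~R))).
  by rewrite cexpD cexp_2pi_int mulr1 cexp_carg.
have w0 : w != 0 by rewrite gt_eqF// freq_gt0.
rewrite /crossing_delay /crossing_phase zE /=.
apply/eqP; rewrite eq_complex /=; apply/andP; split; apply/eqP; first by ring.
rewrite mulr0 add0r mulrA divff// mul1r intrN; ring.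
Qed.

(** Comparing arguments gives an integer [k]. As [carg z > - pi] strictly and [w * tau > 0], it
    satisfies [k > - 1 / 2], so it is a natural number. *)
Lemma delay_of_root (w tau : R) z : w \in [:: w1; w2] -> 0 < tau ->
  Y j w = Some z -> cabs z = 1 -> z = cexp (- ((0 +i* w) * tau%:C)) ->
  exists k : nat, tau = crossing_delay Y j w k.
Proof.
move=> wH tau0 zE z1; have w0 := freq_gt0 wH.
have -> : - ((0 +i* w) * tau%:C) = 0 +i* (- (w * tau)).
  by apply/eqP; rewrite eq_complex /=; apply/andP; split; apply/eqP; ring.
rewrite -[in LHS](cexp_carg z1) => /cexp_im_inj[k kE].
have /andP[cpi _] := carg_bounds z1.
have tE : w * tau = - carg z + 2 * pi * k%:~R by rewrite kE; ring.
have wt0 : 0 < w * tau by rewrite mulr_gt0.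
have p0 := @pi_gt0 R.
have k0 : (0 <= k)%R.
  rewrite -ltzD1 -(ltr0z R) intrD.
  have : 0 < 2 * pi * (k%:~R + 2^-1) :> R.
    apply: lt_trans wt0 _; rewrite tE addrC [ltRHS]mulrDr ltrD2l
      mulrAC divff ?pnatr_eq0// mul1r.
    lra.
  by rewrite pmulr_rgt0 ?mulr_gt0// => ?; lra.
exists `|k|%N; rewrite /crossing_delay /crossing_phase zE /=.
have -> : (`|k|%N%:R : R) = k%:~R by rewrite natr_absz ger0_norm.
by rewrite -tE mulKf// gt_eqF.
Qed.

Lemma root_family_slope w k alpha mu : w \in [:: w1; w2] ->
  let tau := crossing_delay Y j w k in
  (\forall t \near tau, char_root A B t (alpha t +i* mu t)) ->
  alpha tau = 0 -> mu tau = w ->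
  {for tau, continuous alpha} -> {for tau, continuous mu} ->
  exists2 c : R, 0 < c &
  (fun e => e^-1 * (alpha (e + tau) - alpha tau)) @ 0^' -->
    - (c * derive1 (fine \o acs_branch Y j) w).
Proof.
move=> wH tau rootn al0 muw cal cmu.
have [z [zE z1 fz zexp]] := crossing_delay_root k wH.
have [a [b fab]] := sderivable_charf A B (0 +i* w) z.
have b0 := branch_simple wH zE z1 fab.
have gE := branch_slope wH zE z1 fab.
have [[_ g'0] _] := classII_regular classII wH.
set g' := derive1 _ _ in gE g'0 *.
have z0 : z != 0 by rewrite -cabs_gt0 z1.
pose p := a / (b * z).
(* If [p] were the real number [tau], its imaginary part, and with it the slope of the branch, would
   be zero. *)
have pt0 : p - tau%:C != 0.
  rewrite subr_eq0; apply: contraNneq g'0 => pE.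
  by rewrite gE -/p pE /= oppr0.
have fexp := sderiv_cexp fab zexp.
(* These are the partial derivatives of [f l (cexp (- (l * t)))] in [t] and in [l]. *)
pose d : R[i] := - ((0 +i* w) * z * b); pose c : R[i] := a - tau%:C * z * b.
have cE : c = b * z * (p - tau%:C) by rewrite /c /p; field; rewrite z0.
have c0 : c != 0 by rewrite cE !mulf_neq0.
pose lambda e : K := alpha (e + tau) +i* mu (e + tau).
have shift0 : (fun e : R => e + tau) @ (0 : R)^' --> tau.
  rewrite -[X in _ --> X]add0r; apply: cvgD; last exact: cvg_cst.
  exact: nbhs_dnbhs.
have clam : lambda @ (0 : R)^' --> (0 +i* w : K).
  apply/cvg_complexP; split => /=.
    by rewrite -[X in _ --> X]al0; exact: cvg_comp shift0 cal.
  by rewrite -[X in _ --> X]muw; exact: cvg_comp shift0 cmu.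
have ct : (fun e : R => (e + tau)%:C : K) @ (0 : R)^' --> (tau%:C : K).
  exact: cvg_real_complex.
have nn0 : \forall e \near (0 : R)^', e != 0 by exact: nbhs_dnbhs_neq.
have cs : (fun e : R => (e%:C)^-1 * ((e + tau)%:C - tau%:C) : K) @ (0 : R)^' --> (1 : K).
  apply: cvg_trans (@cvg_cst K (1 : K) R (0 : R)^' _); apply: near_eq_cvg.
  apply: filterS nn0 => e e0 /=.
  by rewrite rmorphD /= addrK mulVf// eq_complex /= eqxx andbT.
have rootl : \forall e \near (0 : R)^',
    f (lambda e) (cexp (- (lambda e * (e + tau)%:C))) = 0.
  exact: (near0_shift (P := fun t => char_root A B t (alpha t +i* mu t)) rootn).
have f0 : f (0 +i* w) (cexp (- ((0 +i* w) * tau%:C))) = 0 by rewrite -zexp.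
have cl := sderiv_implicit (FF := dnbhs_filter (0 : R)) (sderiv_flip fexp) c0 f0
  ct clam rootl cs.
exists (w / cabs (p - tau%:C) ^+ 2).
  by apply: divr_gt0; [exact: freq_gt0|rewrite exprn_gt0// cabs_gt0].
have limE : - (d * 1) / c = (0 +i* w) / (p - tau%:C).
  have simp (l u v q : R[i]) : u != 0 -> v != 0 -> q != 0 ->
      - (- (l * v * u) * 1) / (u * v * q) = l / q.
    by move=> u0 v0 q0; field; rewrite u0 v0 q0.
  by rewrite cE; exact: simp.
have /cvg_complexP[+ _] := cl.
rewrite [X in _ --> X -> _](_ : _ = complex.Re ((0 +i* w) / (p - tau%:C))); last first.
  by rewrite -limE.
have -> : g' = - complex.Im (p - tau%:C) by rewrite gE ImB subr0.
have -> : complex.Re ((0 +i* w) / (p - tau%:C)) =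
    - (w / cabs (p - tau%:C) ^+ 2 * - complex.Im (p - tau%:C)).
  by rewrite cabs_sqr; case: (p - _) => u v /=; ring.
apply: cvg_trans; apply: near_eq_cvg; apply: nearW => e.
rewrite -[(e%:C)^-1](fmorphV (real_complex R)) ReZ al0.
by rewrite ReB /= subr0.
Qed.

(** The implicit function theorem gives a root for complex delays near the crossing delay;
    restricting it to real delays gives the family. *)
Lemma exists_root_family w k : w \in [:: w1; w2] ->
  exists alpha mu : R -> R, [/\ root_family A B (crossing_delay Y j w k) alpha mu,
    alpha (crossing_delay Y j w k) = 0 & mu (crossing_delay Y j w k) = w].
Proof.
move=> wH; set tau := crossing_delay Y j w k.
have [z [zE z1 fz zexp]] := crossing_delay_root k wH.
have [a [b fab]] := sderivable_charf A B (0 +i* w) z.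
have b0 := branch_simple wH zE z1 fab.
have gE := branch_slope wH zE z1 fab.
have [[_ g'0] _] := classII_regular classII wH.
have z0 : z != 0 by rewrite -cabs_gt0 z1.
have fexp := sderiv_cexp fab zexp.
(* If the partial derivative in the root vanished, [a / (b * z)] would be the real number [tau] and
   the branch slope zero. *)
have c0 : a - tau%:C * z * b != 0.
  apply: contraNneq g'0 => c0; rewrite gE.
  have -> : a / (b * z) = tau%:C by rewrite (subr0_eq c0); field; rewrite b0 z0.
  by rewrite oppr0.
have f0 : f (0 +i* w) (cexp (- ((0 +i* w) * tau%:C))) = 0 by rewrite -zexp.
have [g g0 gP] := implicit_function c0 fexp f0.
exists (fun t => complex.Re (g t%:C)), (fun t => complex.Im (g t%:C)).
rewrite g0; split=> //.
have ct (t : R) : (fun t : R => t%:C : K) @ t --> (t%:C : K).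
  by apply: cvg_real_complex; exact: cvg_id.
have gR : \forall t \near tau, f (g t%:C) (cexp (- (g t%:C * t%:C))) = 0 /\
    {for t%:C, continuous g} by exact: (ct tau _ gP).
apply: filterS gR => t [ft cg].
have /cvg_complexP[cr ci] : (fun t : R => g t%:C) @ t --> g t%:C.
  exact: cvg_comp (ct t) cg.
split; [| |exact: cr|exact: ci]; first by rewrite /char_root; case: (g t%:C) ft.
have -> : complex.Re (g t%:C) -i* complex.Im (g t%:C) = conjc (g t%:C).
  by case: (g t%:C).
have expJ : - (conjc (g t%:C) * t%:C) = conjc (- (g t%:C * t%:C)).
  by rewrite rmorphN rmorphM /= oppr0.
rewrite /char_root expJ cexp_conjc -/(charf A B _ _) charf_conjc.
by move: ft => ->; rewrite conjc0.
Qed.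

(** This one formula serves both transversality and the direction of the crossing. *)
Lemma root_family_derive w k alpha mu : w \in [:: w1; w2] ->
  root_family A B (crossing_delay Y j w k) alpha mu ->
  alpha (crossing_delay Y j w k) = 0 -> mu (crossing_delay Y j w k) = w ->
  exists2 c : R, 0 < c & is_derive (crossing_delay Y j w k) (1 : R) alpha
    (- (c * derive1 (fine \o acs_branch Y j) w)).
Proof.
move=> wH fam al0 muw; have [_ _ cal cmu] := nbhs_singleton fam.
have rootn : \forall t \near crossing_delay Y j w k,
    char_root A B t (alpha t +i* mu t) by apply: filterS fam => t [].
have [c c0 cq] := root_family_slope wH rootn al0 muw cal cmu.
exists c => //; set l := - (c * _) in cq *.
have cq' : (fun e : R => e^-1 *: ((alpha \o shift (crossing_delay Y j w k)) (e *: 1) -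
    alpha (crossing_delay Y j w k))) @ 0^' --> l.
  apply: cvg_trans cq; apply: near_eq_cvg; apply: nearW => e /=.
  by rewrite [e%:A]mulr1.
by split; [apply/cvg_ex; exists l|exact: cvg_lim].
Qed.

End ClassII.

Theorem corollary5p1 (R : realType) (n : nat) (A B : 'M[R]_n)
    (m : nat) (Y : 'I_m -> R -> option R[i]) (j h : 'I_m) (w1 w2 : R) :
  gen_roots A B Y ->
  universality_class_II A B Y j h w1 w2 ->
  [/\ forall (w : R) (k : nat), w \in [:: w1; w2] ->
        exists alpha mu : R -> R,
          transverse_crossing A B (crossing_delay Y j w k) w alpha mu,
      forall (tauH w : R) (alpha mu : R -> R),
        0 < tauH -> ~ degenerate A B w ->
        transverse_crossing A B tauH w alpha mu ->
        exists (wH : R) (k : nat),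
          [/\ wH \in [:: w1; w2], `|w| = wH & tauH = crossing_delay Y j wH k],
      forall (k : nat) (alpha mu : R -> R),
        transverse_crossing A B (crossing_delay Y j w1 k) w1 alpha mu ->
        destabilizing (crossing_delay Y j w1 k) alpha
    & forall (k : nat) (alpha mu : R -> R),
        transverse_crossing A B (crossing_delay Y j w2 k) w2 alpha mu ->
        stabilizing (crossing_delay Y j w2 k) alpha].
Proof.
move=> rootsY classII.
have slope := root_family_derive rootsY classII.
have w1H : w1 \in [:: w1; w2] by rewrite inE eqxx.
have w2H : w2 \in [:: w1; w2] by rewrite !inE eqxx orbT.
split.
- move=> w k wH.
  have [alpha [mu [fam al0 muw]]] := exists_root_family rootsY classII k wH.
  exists alpha, mu.
  have [c c0 [dal dE]] := slope _ _ _ _ wH fam al0 muw.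
  have [[_ g'0] _] := classII_regular classII wH.
  by split=> //; rewrite derive1E dE oppr_eq0 mulf_neq0// gt_eqF.
- move=> tauH w alpha mu tau0 nd [fam al0 muw _ _].
  have [r1 r2 _ _] := nbhs_singleton fam; rewrite al0 muw in r1 r2.
  have cexpE (v : R) : - ((0 +i* v) * tauH%:C) = 0 +i* (- (v * tauH)) :> R[i].
    by apply/eqP; rewrite eq_complex /=; apply/andP; split; apply/eqP; ring.
  have u1 v : cabs (cexp (- ((0 +i* v) * tauH%:C))) = 1 by rewrite cexpE cabs_cexp_im.
  have [[wH YE]|wH] := unit_root rootsY classII nd (u1 w) r1.
    have [k kE] := delay_of_root classII wH tau0 YE (u1 w) erefl.
    by exists w, k; split=> //; rewrite gtr0_norm// (freq_gt0 classII).
  (* Here [- w] is the class frequency, and the conjugate member of the family is the root at that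
     frequency. *)
  have YE := unit_root_freq rootsY classII wH (u1 (- w)) r2.
  have [k kE] := delay_of_root classII wH tau0 YE (u1 (- w)) erefl.
  have w0 : w < 0 by rewrite -oppr_gt0; exact: (freq_gt0 classII wH).
  by exists (- w), k; split=> //; rewrite ltr0_norm.
- move=> k alpha mu [fam al0 muw _ _]; rewrite /destabilizing derive1E.
  have [c c0 [_ ->]] := slope _ _ _ _ w1H fam al0 muw.
  by rewrite oppr_gt0 pmulr_rlt0// (slope_w1 classII).
- move=> k alpha mu [fam al0 muw _ _]; rewrite /stabilizing derive1E.
  have [c c0 [_ ->]] := slope _ _ _ _ w2H fam al0 muw.
  by rewrite oppr_lt0 pmulr_rgt0// (slope_w2 classII).
Qed.
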